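(* Let $m,N\ge 1$ and let $\mathbf M\in[-1,1]^{m\times N}$ be a feature matrix. For any $\lambda^*\in\mathbb R^N$ and any $\varepsilon>0$, AdaBoost run on $\mathbf M$ achieves loss at most $L(\lambda^* )+\varepsilon$ in at most $\lceil 13\,\|\lambda^*\|_1^6\,\varepsilon^{-5}\rceil$ rounds; that is, for every run of AdaBoost there is a $t\le \lceil 13\|\lambda^*\|_1^6\varepsilon^{-5}\rceil$ with $L(\lambda^t)\le L(\lambda^* )+\varepsilon$.
   Context: Feature matrix: $\mathbf M\in[-1,1]^{m\times N}$, with rows indexed by training examples $i=1,\dots,m$ and columns by weak hypotheses $j=1,\dots,N$ (it arises as $M_{ij}=y_i h_j(x_i)$ with labels $y_i\in\{-1,+1\}$ and weak hypotheses $h_j$ with values in $[-1,+1]$). The exponential loss of $\lambda\in\mathbb R^N$ is $L(\lambda)=\frac1m\sum_{i=1}^m e^{-(\mathbf M\lambda)_i}$. AdaBoost: start with $\lambda^0=0$. In round $t=1,2,\dots$, let $D_t(i)=e^{-(\mathbf M\lambda^{t-1})_i}/\sum_{k=1}^m e^{-(\mathbf M\lambda^{t-1})_k}$, choose a column $j_t$ maximizing $\left|\sum_i D_t(i)M_{ij}\right|$ over $j$ (ties broken arbitrarily), put $r_t=\sum_i D_t(i)M_{ij_t}$ and $\alpha_t=\frac12\ln\frac{1+r_t}{1-r_t}$, and set $\lambda^t=\lambda^{t-1}+\alpha_t\mathbf e_{j_t}$, where $\mathbf e_j$ is the $j$-th standard basis vector. If $|r_t|=1$, the step is infinite; the loss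 after round $t$ is then taken to be its limiting value $0$ and the algorithm stops (all later losses are $0$). The loss is non-increasing in $t$. *)

(* Defs.v *)
From mathcomp Require Import all_boot all_order all_algebra.
From mathcomp Require Import reals sequences exp.

Set Implicit Arguments.
Unset Strict Implicit.
Unset Printing Implicit Defensive.

Import Order.TTheory GRing.Theory Num.Theory.
Local Open Scope ring_scope.

Section AdaBoost.
Variables (R : realType) (m N : nat).
Implicit Types (M : 'M[R]_(m, N)) (lam : 'cV[R]_N).

Definition feature_matrix M : Prop := forall i j, -1 <= M i j <= 1.

Definition norm1 lam : R := \sum_(j < N) `|lam j ord0|.

Definition exp_loss M lam : R :=
  m%:R^-1 * \sum_(i < m) expR (- (M *m lam) i ord0).

Definition weight M lam (i : 'I_m) : R :=
  expR (- (M *m lam) i ord0) / \sum_(k < m) expR (- (M *m lam) k ord0).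

Definition edge M lam (j : 'I_N) : R := \sum_(i < m) weight M lam i * M i j.

Definition best_column M lam (j : 'I_N) : Prop :=
  forall k : 'I_N, `|edge M lam k| <= `|edge M lam j|.

Definition step_size (r : R) : R := 2^-1 * ln ((1 + r) / (1 - r)).

(* [Some lam] is a finite combination; [None] means that some round had an
   edge of absolute value 1, i.e. an infinite step, and the algorithm stopped. *)
Definition state : Type := option 'cV[R]_N.

Definition state_loss M (s : state) : R :=
  if s is Some lam then exp_loss M lam else 0.

Definition update M lam (j : 'I_N) : state :=
  let r := edge M lam j in
  if `|r| == 1 then None else Some (lam + step_size r *: delta_mx j ord0).

(* One round, as a relation because ties are broken arbitrarily; a stopped
   run stays stopped. *)
Definition adaboost_round M (s s' : state) : Prop :=
  if s is Some lam then
    exists2 j : 'I_N, best_column M lam j & s' = update M lam j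
  else s' = None.

(* [s t] is the state after [t] rounds. *)
Definition adaboost_run M (s : nat -> state) : Prop :=
  s 0%N = Some 0 /\ forall t : nat, adaboost_round M (s t) (s t.+1).

End AdaBoost.

(* Main.v *)
Require Import Defs.
From mathcomp Require Import all_boot all_order all_algebra.
From mathcomp Require Import reals sequences exp.
From mathcomp Require Import classical_sets topology normedtype derive realfun.
From mathcomp Require Import ring lra.

Set Implicit Arguments.
Unset Strict Implicit.
Unset Printing Implicit Defensive.

Import Order.TTheory GRing.Theory Num.Theory.
Import numFieldNormedType.Exports.
Local Open Scope classical_set_scope.
Local Open Scope ring_scope.

(** Fix a reference vector v and follow two quantities along the run: the
    suboptimality F = ln L(lam) - ln L(v) and the distance S = |v - lam|_1.
    With B = |v|_1 they start at F <= B and S = B.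

    Since ln L is convex with partial derivatives minus the edges, the
    largest absolute edge d satisfies F <= d S (loss_gap_le): while the run is
    suboptimal and not too far from v, some column has a large edge.  A round
    with edge d lowers F by at least b = - ln(1 - d^2) / 2 (exp_loss_step) and
    raises S by at most a = artanh d (norm1_step), the step size.  So
    everything depends on S not growing too fast.

    The key is the calculus inequality d a <= 2 b (abs_artanh_le): distance is
    only bought with a proportionate decrease of F.  With F <= d S it gives
    a / S <= 2 b / F, that is, S grows in relative terms at most twice as fast
    as F decreases, and therefore S F^2 never increases (potential_le).  Hence
    S F^2 <= B^3 throughout, and F <= d S becomes d >= F^3 / B^3.

    Since b >= d^2 / 2, each round now takes F to at most F - F^6 / (2 B^6), a
    discrete form of F' = - F^6 / (2 B^6), so that F^-5 grows by at least
    5 / (2 B^6) per round (inv_pow5_step).  As long as the loss exceeds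
    L(v) + eps, which is then below L(0) = 1, one has F > eps (ln_gap_gt); this
    bounds F^-5 by eps^-5 and so the number of rounds by a multiple of
    B^6 eps^-5. *)

(** * Two inequalities for the inverse hyperbolic tangent *)

Lemma nneg_derive_le0x (R : realType) (f df : R -> R) (x : R) : 0 <= x ->
  (forall y, 0 <= y <= x -> is_derive y 1 f (df y)) ->
  (forall y, 0 <= y <= x -> 0 <= df y) -> f 0 <= f x.
Proof.
rewrite le_eqVlt => /predU1P[<-//|x0] fdf df0.
have fdf' y : y \in `]0, x[ -> is_derive y 1 f (df y).
  by rewrite in_itv/= => /andP[/ltW ? /ltW ?]; apply: fdf; apply/andP.
have cf : {within `[0, x]%classic, continuous f}.
  apply: derivable_within_continuous => y; rewrite in_itv/= => /fdf h.
  exact: ex_derive.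
have [c] := MVT x0 fdf' cf.
rewrite in_itv/= => /andP[/ltW c0 /ltW cx] e.
rewrite -subr_ge0 e mulr_ge0 ?df0 ?c0// subr0; exact: ltW.
Qed.

Lemma is_derive_1D (R : realType) (y : R) :
  is_derive y 1 (fun x : R => 1 + x) 1.
Proof.
have := is_deriveD (is_derive_cst (1 : R) y 1) (is_derive_id y 1).
by rewrite add0r.
Qed.

Lemma is_derive_1B (R : realType) (y : R) :
  is_derive y 1 (fun x : R => 1 - x) (-1).
Proof.
have := is_deriveB (is_derive_cst (1 : R) y 1) (is_derive_id y 1).
by rewrite sub0r.
Qed.

Lemma is_derive_ln1D (R : realType) (y : R) : -1 < y ->
  is_derive y 1 (fun x : R => ln (1 + x)) (1 + y)^-1.
Proof.
move=> y1.
have h2 : is_derive (1 + y) 1 (@ln R) (1 + y)^-1 by apply: is_derive1_ln; lra.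
by have := is_derive1_comp h2 (is_derive_1D y); rewrite mulr1.
Qed.

Lemma is_derive_ln1B (R : realType) (y : R) : y < 1 ->
  is_derive y 1 (fun x : R => ln (1 - x)) (- (1 - y)^-1).
Proof.
move=> y1.
have h2 : is_derive (1 - y) 1 (@ln R) (1 - y)^-1 by apply: is_derive1_ln; lra.
have := @is_derive1_comp _ (@ln R) (fun x => 1 - x) y _ _ h2 (is_derive_1B y).
by rewrite mulrN1.
Qed.

Definition artanh (R : realType) (x : R) : R :=
  2^-1 * (ln (1 + x) - ln (1 - x)).

Lemma artanh0 (R : realType) : artanh (0 : R) = 0.
Proof. by rewrite /artanh addr0 subr0 subrr mulr0. Qed.

Lemma is_derive_artanh (R : realType) (y : R) : -1 < y < 1 ->
  is_derive y 1 (@artanh R) (1 - y ^+ 2)^-1.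
Proof.
move=> /andP[y0 y1].
have h : is_derive y 1 (@artanh R) _ :=
  is_deriveZ 2^-1 (is_deriveB (is_derive_ln1D y0) (is_derive_ln1B y1)).
apply: (is_derive_eq h); rewrite /GRing.scale/=.
by field; rewrite !gt_eqF//; nra.
Qed.

(** Both sides vanish at 0, and the derivatives (1 + r^2) / (1 - r^2)^2 and
    1 / (1 - r^2) compare pointwise. *)
Lemma artanh_le (R : realType) (r : R) : 0 <= r < 1 ->
  artanh r <= r / (1 - r ^+ 2).
Proof.
move=> /andP[r0 r1].
have q0 (y : R) : 0 <= y <= r -> 0 < 1 - y ^+ 2 by move=> /andP[? ?]; nra.
pose f (x : R) := x * (1 - x ^+ 2)^-1 - artanh x.
rewrite -subr_ge0; have <- : f 0 = 0 by rewrite /f artanh0 mul0r subrr.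
pose df (x : R) := 2 * x ^+ 2 / (1 - x ^+ 2) ^+ 2.
apply: (@nneg_derive_le0x _ f df) => // y yr; last first.
  by rewrite divr_ge0 ?sqr_ge0// mulr_ge0 ?sqr_ge0.
have ha : is_derive y 1 (@artanh R) (1 - y ^+ 2)^-1.
  by apply: is_derive_artanh; move: yr => /andP[? ?]; apply/andP; split; lra.
have hq := is_deriveB (is_derive_cst (1 : R) y 1)
  (is_deriveX 2 (is_derive_id y 1)).
have hV := @is_deriveV _ (fun x => 1 - x ^+ 2) y _ _ (lt0r_neq0 (q0 y yr)) hq.
have h : is_derive y 1 f _ := is_deriveB (is_deriveM (is_derive_id y 1) hV) ha.
apply: (is_derive_eq h).
have := lt0r_neq0 (q0 y yr).
rewrite /df /GRing.scale/= => ?; by field.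
Qed.

(** With r = tanh a this is (a / 2) tanh a <= ln cosh a.  Both sides agree to
    second order at 0, so the constant cannot be improved; the derivative of
    the difference is r / (1 - r^2) - artanh r. *)
Lemma mul_artanh_le (R : realType) (r : R) : 0 <= r < 1 ->
  r * artanh r <= - (ln (1 + r) + ln (1 - r)).
Proof.
move=> /andP[r0 r1].
pose f (x : R) := - (ln (1 + x) + ln (1 - x)) - x * artanh x.
rewrite -subr_ge0; have <- : f 0 = 0.
  by rewrite /f artanh0 !(addr0, subr0, ln1, mulr0, oppr0).
pose df (x : R) := x / (1 - x ^+ 2) - artanh x.
apply: (@nneg_derive_le0x _ f df) => // y /andP[y0 yr]; last first.
  by rewrite subr_ge0 artanh_le// y0/=; lra.
have y1 : -1 < y by lra.
have y2 : y < 1 by lra.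
have ha : is_derive y 1 (@artanh R) (1 - y ^+ 2)^-1.
  by apply: is_derive_artanh; apply/andP.
have h : is_derive y 1 f _ := is_deriveB
  (is_deriveN (is_deriveD (is_derive_ln1D y1) (is_derive_ln1B y2)))
  (is_deriveM (is_derive_id y 1) ha).
apply: (is_derive_eq h).
rewrite /df /GRing.scale/=; field.
by rewrite !gt_eqF//; nra.
Qed.

Lemma artanhN (R : realType) (r : R) : artanh (- r) = - artanh r.
Proof. by rewrite /artanh opprK -mulrN opprB. Qed.

(** A round with edge r moves by artanh r and lowers ln L by at least half of
    the right-hand side: this is the exchange rate between distance travelled
    and progress made. *)
Lemma abs_artanh_le (R : realType) (r : R) : `|r| < 1 ->
  `|r| * `|artanh r| <= - (ln (1 + r) + ln (1 - r)).
Proof.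
have pos (x : R) : 0 <= x < 1 ->
    `|x| * `|artanh x| <= - (ln (1 + x) + ln (1 - x)).
  move=> /[dup] /andP[x0 x1] x01; rewrite (ger0_norm x0) ger0_norm.
    exact: mul_artanh_le.
  by rewrite /artanh mulr_ge0 ?invr_ge0// subr_ge0 ler_ln ?posrE; lra.
move=> r1; have [r0|/ltW r0] := leP 0 r.
  by apply: pos; rewrite r0 -(ger0_norm r0).
have := pos (- r); rewrite artanhN !normrN opprK [ln (1 - r) + _]addrC; apply.
by rewrite oppr_ge0 r0 -(ler0_norm r0).
Qed.

Lemma sqr_le_ln1DB (R : realType) (r : R) : `|r| < 1 ->
  `|r| ^+ 2 <= - (ln (1 + r) + ln (1 - r)).
Proof.
rewrite real_normK ?num_real// ltr_norml => /andP[? ?].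
rewrite -lnM ?posrE; [|lra|lra].
have -> : (1 + r) * (1 - r) = 1 + - r ^+ 2 by ring.
by rewrite lerNr le_ln1Dx// ltrN2; nra.
Qed.

(** * The exponential loss and one boosting step *)

(** The tangent of expR at the mean mu lies below expR, and its weighted
    average is its value at mu. *)
Lemma jensen_expR (R : realType) (I : finType) (w x : I -> R) :
  (forall i, 0 <= w i) ->
  \sum_i w i = 1 -> expR (\sum_i w i * x i) <= \sum_i w i * expR (x i).
Proof.
move=> w0 w1; set mu := \sum_i _.
have -> : expR mu = \sum_i w i * (expR mu * (1 + (x i - mu))).
  under eq_bigr do rewrite mulrCA.
  rewrite -mulr_sumr; under eq_bigr do rewrite addrCA mulrDr.
  rewrite big_split/= -/mu -mulr_suml w1; ring.
apply: ler_sum => i _; apply: ler_wpM2l => //.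
rewrite -[in leRHS](subrKC mu (x i)) expRD ler_wpM2l ?expR_ge0//.
exact: expR_ge1Dx.
Qed.

Arguments jensen_expR {R I w} x.

(** Jensen for the two points - a and a: the point - a x is their mean with
    weights (1 + x) / 2 and (1 - x) / 2. *)
Lemma expR_chord (R : realType) (a x : R) : -1 <= x <= 1 ->
  expR (- (a * x)) <= (1 + x) / 2 * expR (- a) + (1 - x) / 2 * expR a.
Proof.
move=> /andP[x0 x1].
have := @jensen_expR _ _ (fun b => if b then (1 + x) / 2 else (1 - x) / 2)
  (fun b => if b then - a else a).
rewrite !big_bool /=.
have -> : (1 + x) / 2 * - a + (1 - x) / 2 * a = - (a * x) by field.
by apply; [case; lra | field].
Qed.

Section Loss.
Context (R : realType) (m N : nat) (m_gt0 : (0 < m)%N) (M : 'M[R]_(m, N)).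
Implicit Types (lam v : 'cV[R]_N).

Lemma sum_expR_gt0 lam : 0 < \sum_(i < m) expR (- (M *m lam) i ord0).
Proof.
rewrite (bigD1 (Ordinal m_gt0))//= ltr_pwDl ?expR_gt0//.
by apply: sumr_ge0 => i _; exact: expR_ge0.
Qed.

Lemma exp_loss_gt0 lam : 0 < exp_loss M lam.
Proof. by rewrite mulr_gt0 ?sum_expR_gt0// invr_gt0 ltr0n. Qed.

Lemma weight_ge0 lam i : 0 <= weight M lam i.
Proof. by rewrite divr_ge0 ?expR_ge0// ltW// sum_expR_gt0. Qed.

Lemma sum_weight lam : \sum_(i < m) weight M lam i = 1.
Proof. by rewrite -mulr_suml divff// gt_eqF// sum_expR_gt0. Qed.

(** A move by v multiplies the loss by an average over the current weights;
    every estimate of a change of loss is read off this factor. *)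
Lemma exp_lossD lam v : exp_loss M (lam + v) =
  exp_loss M lam * \sum_(i < m) weight M lam i * expR (- (M *m v) i ord0).
Proof.
rewrite /exp_loss -mulrA; congr (_ * _); rewrite mulr_sumr.
apply: eq_bigr => i _; rewrite mulmxDr mxE opprD expRD /weight.
by field; rewrite gt_eqF// sum_expR_gt0.
Qed.

Lemma sum_weight_edge lam v :
  \sum_(i < m) weight M lam i * (M *m v) i ord0 =
  \sum_(j < N) edge M lam j * v j ord0.
Proof.
under eq_bigr do rewrite mxE mulr_sumr.
rewrite exchange_big; apply: eq_bigr => j _; rewrite mulr_suml.
by apply: eq_bigr => i _; rewrite mulrA.
Qed.

(** This is convexity of ln L: the average of exp(- M v) is at least the
    exponential of minus the average of M v, which is the pairing of the edges
    with v; the best column dominates all the edges. *)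
Lemma loss_gap_le lam v j : best_column M lam j ->
  ln (exp_loss M lam) - ln (exp_loss M (lam + v)) <= `|edge M lam j| * norm1 v.
Proof.
move=> best.
have e0 := exp_loss_gt0 lam.
have := exp_loss_gt0 (lam + v); rewrite exp_lossD (pmulr_rgt0 _ e0) => s0.
rewrite lnM ?posrE// opprD addrA subrr sub0r lerNl -ler_expR lnK ?posrE//.
apply: le_trans (jensen_expR (fun i => - (M *m v) i ord0)
  (weight_ge0 lam) (sum_weight lam)).
rewrite ler_expR.
under [leRHS]eq_bigr do rewrite mulrN.
rewrite sumrN sum_weight_edge lerN2 /norm1 mulr_sumr; apply: ler_sum => k _.
by apply: le_trans (ler_norm _) _; rewrite normrM ler_wpM2r.
Qed.

Lemma abs_edge_le1 lam j : feature_matrix M -> `|edge M lam j| <= 1.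
Proof.
move=> hM; rewrite -(sum_weight lam); apply: le_trans (ler_norm_sum _ _ _) _.
apply: ler_sum => i _; rewrite normrM ger0_norm ?weight_ge0//.
by rewrite ler_piMr ?weight_ge0// ler_norml.
Qed.

Lemma step_sizeE (r : R) : `|r| < 1 -> step_size r = artanh r.
Proof.
by rewrite ltr_norml => /andP[? ?]; rewrite /step_size ln_div ?posrE//; lra.
Qed.

(** The chord bound makes the loss factor at most
    (1 + r) / 2 * exp(- a) + (1 - r) / 2 * exp a, and the step size a is the
    minimizer of this expression, with minimum sqrt (1 - r^2). *)
Lemma exp_loss_step lam j : feature_matrix M -> `|edge M lam j| < 1 ->
  let r := edge M lam j in
  ln (exp_loss M (lam + step_size r *: delta_mx j ord0)) <=
  ln (exp_loss M lam) + 2^-1 * (ln (1 + r) + ln (1 - r)).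
Proof.
move=> hM; set r := edge M lam j => r1; rewrite /=; set a := step_size r.
have : -1 < r < 1 by rewrite -ltr_norml.
move=> /andP[rN1 r1'].
pose v : 'cV[R]_N := a *: delta_mx j ord0.
pose s := \sum_(i < m) weight M lam i * expR (- (M *m v) i ord0).
have e0 := exp_loss_gt0 lam.
have s0 : 0 < s.
  have := exp_loss_gt0 (lam + v).
  by rewrite exp_lossD (pmulr_rgt0 _ e0).
rewrite -/v exp_lossD -/s lnM ?posrE// lerD2l -ler_expR lnK ?posrE//.
have -> : expR (2^-1 * (ln (1 + r) + ln (1 - r))) =
    (1 + r) / 2 * expR (- a) + (1 - r) / 2 * expR a.
  have eD : 1 + r = expR (ln (1 + r)) by rewrite lnK// posrE; lra.
  have eB : 1 - r = expR (ln (1 - r)) by rewrite lnK// posrE; lra.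
  rewrite /a step_sizeE// /artanh; set x := ln (1 + r); set y := ln (1 - r).
  rewrite -/x in eD; rewrite -/y in eB.
  rewrite eD eB ![_ / 2]mulrC -!mulrA -!expRD.
  have -> : x - 2^-1 * (x - y) = 2^-1 * (x + y) by field.
  have -> : y + 2^-1 * (x - y) = 2^-1 * (x + y) by field.
  by field.
(* Bound by the chord in each row; the result is affine in M i j, so its
   average only depends on the edge. *)
apply: (@le_trans _ _ (\sum_(i < m) weight M lam i *
    ((1 + M i j) / 2 * expR (- a) + (1 - M i j) / 2 * expR a))).
  apply: ler_sum => i _; apply: ler_wpM2l; first exact: weight_ge0.
  rewrite -scalemxAr mxE -colE mxE; exact: expR_chord.
pose p := (expR (- a) + expR a) / 2; pose q := (expR (- a) - expR a) / 2.
have -> : (1 + r) / 2 * expR (- a) + (1 - r) / 2 * expR a =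
    (\sum_(i < m) weight M lam i) * p + r * q.
  by rewrite sum_weight /p /q; field.
rewrite /r /edge !mulr_suml -big_split/= le_eqVlt; apply/orP; left; apply/eqP.
by apply: eq_bigr => i _; rewrite /p /q; field.
Qed.

Lemma norm1_step lam v a j :
  norm1 (v - (lam + a *: delta_mx j ord0)) <= norm1 (v - lam) + `|a|.
Proof.
have -> : `|a| = norm1 (a *: delta_mx j ord0 : 'cV[R]_N).
  rewrite /norm1 (bigD1 j)//= !mxE !eqxx mulr1 big1 ?addr0// => k kj.
  by rewrite !mxE (negPf kj) mulr0 normr0.
rewrite /norm1 -big_split; apply: ler_sum => k _ /=.
by rewrite opprD addrA !mxE ler_normB.
Qed.

Lemma abs_mulmx_le v i : feature_matrix M -> `|(M *m v) i ord0| <= norm1 v.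
Proof.
move=> hM; rewrite mxE; apply: le_trans (ler_norm_sum _ _ _) _.
by apply: ler_sum => j _; rewrite normrM ler_piMl// ler_norml.
Qed.

Lemma exp_loss0 : exp_loss M 0 = 1.
Proof.
rewrite /exp_loss; under eq_bigr do rewrite mulmx0 mxE oppr0 expR0.
by rewrite sumr_const card_ord mulVf// pnatr_eq0 -lt0n.
Qed.

Lemma ln_exp_loss_ge v : feature_matrix M -> - norm1 v <= ln (exp_loss M v).
Proof.
move=> hM; rewrite -ler_expR lnK ?posrE ?exp_loss_gt0//.
rewrite /exp_loss ler_pdivlMl ?ltr0n//.
rewrite mulr_natl -[m in X in X <= _]card_ord -sumr_const.
apply: ler_sum => i _; rewrite ler_expR lerN2.
by apply: le_trans (ler_norm _) (abs_mulmx_le _ _ hM).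
Qed.

End Loss.

(** * The potential and the recurrence *)

(** Here a / S <= 2 b / F, so with x = b / F the ratio of the potentials is at
    most (1 + 2 x) (1 - x)^2 = 1 - 3 x^2 + 2 x^3, which is at most 1 for
    0 <= x <= 1.  The power 2 of F matches the constant in d a <= 2 b. *)
Lemma potential_le (R : realFieldType) (F F' S S' d a b : R) :
  0 < F -> 0 < F' -> 0 <= S -> 0 <= S' -> 0 <= a ->  0 <= b ->
  F <= d * S -> d * a <= 2 * b -> F' <= F - b -> S' <= S + a ->
  S' * F' ^+ 2 <= S * F ^+ 2.
Proof.
move=> F0 F'0 S0 S'0 a0 b0 FdS dab F'F S'S.
have h1 : S' * F' ^+ 2 <= (S + a) * (F - b) ^+ 2.
  by apply: ler_pM => //; rewrite ?sqr_ge0// ler_pXn2r// nnegrE; lra.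
apply: le_trans h1 _; rewrite -(ler_pM2r F0).
have h2 : F * a <= 2 * b * S.
  apply: (@le_trans _ _ (d * S * a)); first exact: ler_wpM2r.
  by rewrite mulrAC ler_wpM2r.
have bF : b < F by lra.
apply: (@le_trans _ _ (S * (F + 2 * b) * (F - b) ^+ 2)).
  rewrite mulrAC ler_wpM2r ?sqr_ge0//; lra.
have -> : S * (F + 2 * b) * (F - b) ^+ 2 =
  S * (F ^+ 3 - b ^+ 2 * (3 * F - 2 * b)) by ring.
have -> : S * F ^+ 2 * F = S * F ^+ 3 by ring.
rewrite ler_wpM2l// gerBl mulr_ge0 ?sqr_ge0//; lra.
Qed.

(** With u = y / x one has c <= (1 - u) x^-5, so it suffices that
    1 + 5 (1 - u) <= u^-5: the convex function u^-5 lies above its tangent at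
    u = 1. *)
Lemma inv_pow5_step (R : realFieldType) (x y c : R) : 0 < x -> 0 < y ->
  0 <= c -> y <= x - c * x ^+ 6 -> x ^- 5 + 5 * c <= y ^- 5.
Proof.
move=> x0 y0 c0 yx; pose u := y / x.
have u0 : 0 < u by rewrite divr_gt0.
have x5 : 0 < x ^- 5 by rewrite invr_gt0 exprn_gt0.
have cu : c <= (1 - u) * x ^- 5.
  have e : (1 - u) * x ^- 5 * x ^+ 6 = x - y.
    by rewrite /u; field; rewrite gt_eqF.
  by rewrite -(ler_pM2r (exprn_gt0 6 x0)) e; lra.
have -> : y ^- 5 = x ^- 5 * u ^- 5 by rewrite /u; field; rewrite !gt_eqF.
apply: (@le_trans _ _ (x ^- 5 * (1 + 5 * (1 - u)))); first by nra.
rewrite ler_pM2l// -[leRHS]mul1r ler_pdivlMr ?exprn_gt0//.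
rewrite -subr_ge0.
(* The double root at 1 reflects the tangency. *)
have -> : 1 - (1 + 5 * (1 - u)) * u ^+ 5 =
  (1 - u) ^+ 2 * (1 + 2 * u + 3 * u ^+ 2 + 4 * u ^+ 3 + 5 * u ^+ 4) by ring.
by rewrite mulr_ge0 ?sqr_ge0// !addr_ge0// mulr_ge0// ?exprn_ge0// ltW.
Qed.

Lemma adaboost_round_progress (R : realType) (m N : nat) (hm : (0 < m)%N)
    (M : 'M[R]_(m, N)) (hM : feature_matrix M) (v lam : 'cV[R]_N) j :
  let lam' := lam + step_size (edge M lam j) *: delta_mx j ord0 in
  let F x := ln (exp_loss M x) - ln (exp_loss M v) in
  let S x := norm1 (v - x) in
  best_column M lam j -> `|edge M lam j| < 1 -> 0 < F lam -> 0 < F lam' ->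
  [/\ S lam' * F lam' ^+ 2 <= S lam * F lam ^+ 2,
      F lam <= `|edge M lam j| * S lam &
      F lam' <= F lam - 2^-1 * `|edge M lam j| ^+ 2].
Proof.
move=> /= best r1 F0 F'0; set r := edge M lam j in best r1 F'0 *.
set lam' := lam + _ in F'0 *.
pose b := - (2^-1 * (ln (1 + r) + ln (1 - r))).
have gap : ln (exp_loss M lam) - ln (exp_loss M v) <= `|r| * norm1 (v - lam).
  by have := loss_gap_le hm (v - lam) best; rewrite subrKC.
have bE : - (ln (1 + r) + ln (1 - r)) = 2 * b by rewrite /b; field.
have rb : `|r| ^+ 2 <= 2 * b by rewrite -bE; exact: sqr_le_ln1DB.
have b0 : 0 <= b by have := sqr_ge0 `|r|; lra.
have drop : ln (exp_loss M lam') <= ln (exp_loss M lam) - b.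
  by rewrite opprK; exact: exp_loss_step.
have norm1_ge0 x : 0 <= norm1 (x : 'cV[R]_N) by apply: sumr_ge0.
split => //; last by lra.
apply: (@potential_le _ _ _ _ _ `|r| `|artanh r| b) => //.
- by rewrite -bE; exact: abs_artanh_le.
- lra.
- by rewrite /lam' step_sizeE//; exact: norm1_step.
Qed.

(** Since ln y - ln x >= 1 - x / y and y > x + e, the gap exceeds
    e / (x + e), and x + e < 1. *)
Lemma ln_gap_gt (R : realType) (x y e : R) : 0 < x -> 0 < e ->
  x + e < 1 -> x + e < y -> e < ln y - ln x.
Proof.
move=> x0 e0 xe1 xey.
have h : ln (x / y) <= x / y - 1.
  have := @le_ln1Dx R (x / y - 1); rewrite subrKC; apply.
  by rewrite ltrBrDl subrr divr_gt0//; lra.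
rewrite ln_div ?posrE// in h; last by lra.
suff : x / y < 1 - e by lra.
by rewrite ltr_pdivrMr; nra.
Qed.

(** As long as the loss stays above L(v), no round has an edge of absolute
    value 1 (the loss would drop to 0), the potential keeps its initial bound
    B^3, and F^-5 grows linearly.  The norm of v is positive because it bounds
    the initial F, which is positive. *)
Lemma adaboost_run_progress (R : realType) (m N : nat) (hm : (0 < m)%N)
    (M : 'M[R]_(m, N)) (hM : feature_matrix M) (v : 'cV[R]_N)
    (s : nat -> state R N) (hs : adaboost_run M s) (T : nat) :
  let F x := ln (exp_loss M x) - ln (exp_loss M v) in
  let S x := norm1 (v - x) in
  (forall t, (t <= T)%N -> exp_loss M v < state_loss M (s t)) ->
  0 < norm1 v /\
  forall t, (t <= T)%N -> exists lam, [/\ s t = Some lam, 0 < F lam,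
     S lam * F lam ^+ 2 <= norm1 v ^+ 3 &
     5 * t%:R / (2 * norm1 v ^+ 6) <= F lam ^- 5].
Proof.
move=> F S bad; set B := norm1 v.
have L0 := exp_loss_gt0 hm M.
have [s0 hstep] := hs.
have Fpos lam t : (t <= T)%N -> s t = Some lam -> 0 < F lam.
  move=> tT e; have := bad t tT; rewrite e /= => h.
  by rewrite subr_gt0 ltr_ln ?posrE.
have F0 : 0 < F 0 by exact: Fpos s0.
have FB : F 0 <= B.
  rewrite /F exp_loss0// ln1 sub0r lerNl; exact: ln_exp_loss_ge.
have B0 : 0 < B by exact: lt_le_trans FB.
split=> //; elim=> [_|t IH tT].
  exists 0; split => //.
  - by rewrite /S subr0 -/B [leRHS]exprS ler_pM2l// ler_pXn2r// nnegrE ltW.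
  - by rewrite mulr0 mul0r invr_ge0 exprn_ge0// ltW.
have [lam [e Fl pot inv]] := IH (ltnW tT).
have := hstep t; rewrite e /= => -[j best]; rewrite /update.
have [_ e'|r1 e'] := eqVneq `|edge M lam j| 1.
  by have := bad t.+1 tT; rewrite e'/= ltNge ltW.
have r1' : `|edge M lam j| < 1 by rewrite lt_neqAle r1 abs_edge_le1.
have F'0 := Fpos _ _ tT e'.
have [pot' gap drop] := adaboost_round_progress hm hM best r1' Fl F'0.
eexists; split; [exact: e'|exact: F'0|exact: le_trans pot' pot|].
set x := F lam in Fl pot inv pot' gap drop *; set y := F _ in F'0 pot' drop *.
set d := `|edge M lam j| in gap drop *.
have dB : x ^+ 3 <= d * B ^+ 3.
  apply: (@le_trans _ _ (d * S lam * x ^+ 2)).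
    by rewrite [leLHS]exprS ler_wpM2r ?sqr_ge0.
  by rewrite -mulrA ler_wpM2l// /d.
have d2 : x ^+ 6 / B ^+ 6 <= d ^+ 2.
  rewrite ler_pdivrMr ?exprn_gt0// (exprM x 3 2) (exprM B 3 2) -exprMn.
  have x3 : 0 <= x ^+ 3 by rewrite exprn_ge0// ltW.
  by rewrite ler_pXn2r// nnegrE (le_trans x3).
pose c := (2 * B ^+ 6)^-1.
have c0 : 0 <= c by rewrite invr_ge0 mulr_ge0// exprn_ge0// ltW.
have yx : y <= x - c * x ^+ 6.
  have -> : c * x ^+ 6 = 2^-1 * (x ^+ 6 / B ^+ 6).
    by rewrite /c; field; rewrite gt_eqF.
  by apply: le_trans drop _; rewrite lerD2l lerN2 ler_pM2l// invr_gt0.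
apply: le_trans (inv_pow5_step Fl F'0 c0 yx).
apply: le_trans (lerD inv (lexx (5 * c))).
by rewrite /c -(natr1 t) mulrDr mulrDl mulr1.
Qed.

(** * The convergence rate *)

Theorem theorem1 (R : realType) (m N : nat) (hm : (1 <= m)%N) (hN : (1 <= N)%N)
    (M : 'M[R]_(m, N)) (hM : feature_matrix M)
    (lamstar : 'cV[R]_N) (eps : R) (heps : 0 < eps)
    (s : nat -> state R N) (hs : adaboost_run M s) :
  exists t : nat,
    (t%:Z <= Num.ceil (13 * norm1 lamstar ^+ 6 * eps ^- 5))%R /\
    state_loss M (s t) <= exp_loss M lamstar + eps.
Proof.
set B := norm1 lamstar; set K := 13 * _ * _.
have B0 : 0 <= B by apply: sumr_ge0.
have K0 : 0 <= K by rewrite !mulr_ge0 ?invr_ge0 ?exprn_ge0// ltW.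
have [T TE] : exists T : nat, Num.ceil K = T%:Z.
  by exists `|Num.ceil K|%N; rewrite gez0_abs// ceil_ge0; lra.
have KT : K <= T%:R.
  by have := ceil_ge K; rewrite TE.
case: (boolP [exists t : 'I_T.+1,
    state_loss M (s t) <= exp_loss M lamstar + eps]).
  by move=> /existsP[t ht]; exists t; split=> //; rewrite TE lez_nat -ltnS.
rewrite negb_exists => /forallP bad0.
have bad t : (t <= T)%N -> exp_loss M lamstar + eps < state_loss M (s t).
  by rewrite -ltnS => tT; have := bad0 (Ordinal tT); rewrite -ltNge.
exfalso.
have [|B1 inv] := @adaboost_run_progress _ _ _ hm M hM lamstar s hs T.
  by move=> t /bad; apply: lt_trans; rewrite ltrDl.
have [lam [e F0 _ h]] := inv T (leqnn T).
(* The bound x + e < 1 of ln_gap_gt comes from round 0: the initial loss 1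
   already exceeds the target. *)
have Fe : eps < ln (exp_loss M lam) - ln (exp_loss M lamstar).
  apply: ln_gap_gt => //.
  - exact: exp_loss_gt0.
  - by have := bad 0%N (leq0n T); rewrite (proj1 hs)/= exp_loss0.
  - by have := bad T (leqnn T); rewrite e.
set F := (ln _ - _) in Fe F0 h.
have hF : F ^- 5 < eps ^- 5.
  by rewrite ltf_pV2 ?posrE ?exprn_gt0// ltr_pXn2r// nnegrE ltW.
(* With T >= K the linear growth puts F^-5 above (65 / 2) eps^-5, whereas
   F > eps puts it below eps^-5. *)
have : 5 * K / (2 * B ^+ 6) <= 5 * T%:R / (2 * B ^+ 6).
  by rewrite ler_wpM2r ?ler_wpM2l// invr_ge0 mulr_ge0// exprn_ge0.
have -> : 5 * K / (2 * B ^+ 6) = 65 / 2 * eps ^- 5.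
  by rewrite /K; field; rewrite !gt_eqF.
have e5 : 0 < eps ^- 5 by rewrite invr_gt0 exprn_gt0.
move: h; rewrite -/B; lra.
Qed.
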